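(* Let $p$ be a prime, $r\ge1$, $q=p^{2r}$, $s\ge1$, and $d$ a positive integer with $d\mid p^r+1$. Let $X$ be the projective hypersurface in $\mathbb{P}^s$ defined by $x_0^d+x_1^d+\cdots+x_s^d=0$, and let $N'_{k,s}$ be the number of its points in $\mathbb{P}^s(\mathbb{F}_{q^k})$. Then its zeta function $Z_s(t)=\exp\big(\sum_{k\ge1}N'_{k,s}t^k/k\big)$ is \[ Z_s(t)=\begin{cases}\dfrac{(1+q^{(s-1)/2}t)^{B(d,s+1)}}{\prod_{i=0}^{s-1}(1-q^it)}, & s\text{ even},\\[2ex] \dfrac{1}{(1-q^{(s-1)/2}t)^{B(d,s+1)}\prod_{i=0}^{s-1}(1-q^it)}, & s\text{ odd},\end{cases} \] where $B(d,m)=\frac1d\big((d-1)^m+(-1)^m(d-1)\big)$. Equivalently, $N'_{k,s}=\frac{q^{ks}-1}{q^k-1}+(-1)^{(k+1)(s+1)}q^{k(s-1)/2}B(d,s+1)$ for all $k\ge1$.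
   Context: $\mathbb{P}^s(\mathbb{F}_{q^k})$ denotes the set of nonzero $(s+1)$-tuples over $\mathbb{F}_{q^k}$ modulo nonzero scalar multiples. *)

(* Defs.v *)
From HB Require Import structures.
From mathcomp Require Import all_boot all_order all_algebra all_field.
Set Implicit Arguments. Unset Strict Implicit. Unset Printing Implicit Defensive.
Import GRing.Theory Num.Theory.
Local Open Scope ring_scope.

Definition tup (F : finFieldType) (s : nat) := {ffun 'I_s.+1 -> F}.

Definition proj_class (F : finFieldType) (s : nat) (x : tup F s) : {set tup F s} :=
  [set [ffun i => c * x i] | c in [set c : F | c != 0]].

Definition fermat_eq (F : finFieldType) (s d : nat) (x : tup F s) : bool :=
  \sum_(i < s.+1) x i ^+ d == 0.

Definition fermat_points (F : finFieldType) (s d : nat) : {set {set tup F s}} :=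
  [set proj_class x | x in [set x : tup F s | (x != 0) && fermat_eq d x]].

Definition Npts (F : finFieldType) (s d : nat) : nat := #|fermat_points F s d|.

Definition Bdm (d m : nat) : int :=
  ((((d%:Z - 1) ^+ m) + (-1) ^+ m * (d%:Z - 1)) %/ d%:Z)%Z.

(* Main.v *)
Require Import Defs.
From HB Require Import structures.
From mathcomp Require Import all_boot all_order all_fingroup all_algebra all_field.
From mathcomp Require Import all_character.
From mathcomp Require Import zify ring.
Import GRing.Theory Num.Theory.
Set Implicit Arguments.
Unset Strict Implicit.
Unset Printing Implicit Defensive.
Local Open Scope ring_scope.

(** Put h = p^r, F = F_Q with Q = h^(2k), and S_m(a) = sum_x psi(a x^m), where
psi is a nontrivial additive character of F factoring through the trace to F_h.
For m = h + 1, |S_m(a)|^2 is Q times a character sum over the radical of a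
Hermitian form, and the radical has 1 or h^2 elements. As S_m(a) is real and
congruent to 1 modulo h + 1, this leaves only the values E = (-h)^k and
(1 - m) E for a <> 0; the congruence is what fixes the sign. Averaging
S_(h+1)(a y^d) over y <> 0 gives S_d(a) in {E, (1 - d) E} for every d dividing
h + 1, and sum_a S_d(a) = Q gives the frequency of each value. The number of
affine solutions is the average over a in F of S_d(a)^(s+1). *)

(** * Power maps on the cyclic group of units of a finite field *)

Section PowerMap.
Variable F : finFieldType.
Implicit Types (x y z c : F) (m : nat).

Lemma card_units_gt0 : (0 < #|F|.-1)%N.
Proof. by rewrite -subn1 subn_gt0 finNzRing_gt1. Qed.

Lemma card_neq0 : #|[pred x : F | x != 0]| = #|F|.-1.
Proof. by rewrite -(cardsC1 (0 : F)); apply: eq_card => x; rewrite !inE. Qed.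

Lemma expf_card_pred x : x != 0 -> x ^+ #|F|.-1 = 1.
Proof.
move=> x0; apply: (mulfI x0).
by rewrite -exprS prednK ?(ltnW (finNzRing_gt1 F)) // expf_card mulr1.
Qed.

Lemma finField_prim_root : exists z, (#|F|.-1).-primitive_root z.
Proof.
have /hasP[z _ pz] : has (#|F|.-1).-primitive_root (enum [set x : F | x != 0]).
  apply: cyclic.has_prim_root; rewrite ?card_units_gt0 ?enum_uniq //; last first.
    by rewrite -cardE cardsE card_neq0.
  apply/allP=> x; rewrite mem_enum inE => x0.
  by apply/unity_rootP; apply: expf_card_pred.
by exists z.
Qed.

Lemma card_unity_roots m : (m %| #|F|.-1)%N -> #|[set x : F | x ^+ m == 1]| = m.
Proof.
move=> dm; have [z pz] := finField_prim_root.
have pw := dvdn_prim_root pz dm; set w := z ^+ _ in pw.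
have m0 := prim_order_gt0 pw.
have winj : injective (fun i : 'I_m => w ^+ i).
  move=> i j /eqP; rewrite (eq_prim_root_expr pw) !modn_small // => /eqP.
  exact: val_inj.
rewrite -[RHS]card_ord -(card_imset _ winj); apply: eq_card => x.
rewrite inE; apply/eqP/imsetP => [/(prim_rootP pw)[i ->]|[i _ ->]].
  by exists i.
by rewrite exprAC (prim_expr_order pw) expr1n.
Qed.

Lemma card_pow_fibre m y : (m %| #|F|.-1)%N -> y != 0 ->
  #|[set x | x ^+ m == y ^+ m]| = m.
Proof.
move=> dm y0; rewrite -[RHS](card_unity_roots dm).
rewrite -[RHS](card_imset _ (mulfI y0)); apply: eq_card => x.
rewrite inE; apply/eqP/imsetP => [e|[u]].
  exists (x / y); last by rewrite mulrC divfK.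
  by rewrite inE expr_div_n e divff // expf_neq0.
by rewrite inE => /eqP e ->; rewrite exprMn e mulr1.
Qed.

(** Such a [c] is a root of unity of order dividing (|F| - 1)/m, hence a power of [z ^+ m] for a
    generator [z] of the units. This will show that -1 is an (h+1)-st power. *)
Lemma expf_root m c : (m %| #|F|.-1)%N -> c ^+ (#|F|.-1 %/ m) = 1 ->
  exists z, z ^+ m = c.
Proof.
have [z pz] := finField_prim_root; have n0 := prim_order_gt0 pz.
case/dvdnP=> q eq_n; rewrite eq_n in pz n0 *.
move: n0; rewrite muln_gt0 => /andP[q0 m0]; rewrite mulnK //.
have := dvdn_prim_root pz (dvdn_mulr m (dvdnn q)); rewrite mulKn // => pw.
move=> /(prim_rootP pw)[i ->]; exists (z ^+ i).
by rewrite exprAC.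
Qed.

End PowerMap.

(** * Additive characters with algebraic integer values *)

(** Conjugation serves to compute norms of power sums and to prove them real; integrality of the
    values yields their congruences. *)
Definition additive_char (U : finZmodType) (psi : U -> algC) :=
  [/\ psi 0 = 1, forall x y, psi (x + y) = psi x * psi y,
      forall x, psi (- x) = (psi x)^* & forall x, psi x \in Aint].

(** The irreducible characters of an abelian group are linear, and their kernels meet only in the
    identity. *)
Lemma separating_linear_char (U : finZmodType) (x : U) : x != 0 ->
  exists psi : U -> algC,
    additive_char psi /\ psi x != 1.
Proof.
move=> x0; pose G : {group U} := [set: U]%G.
have linG (i : Iirr G) : 'chi_i \is a linear_char.
  exact/char_abelianP/FinRing.zmod_abelian.
have [i xi] : exists i : Iirr G, x \notin cfker 'chi_i.
  apply/existsP; rewrite -negb_forall; apply: contra x0 => /forallP kx.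
  have : x \in \bigcap_i cfker 'chi[G]_i by apply/bigcapP=> i _; apply: kx.
  by rewrite TI_cfker_irr inE.
exists 'chi_i; split; first split=> [|y z|y|y].
- exact: lin_char1 (linG i).
- by rewrite -(lin_charM (linG i)) ?inE.
- by rewrite -(lin_charV_conj (linG i)) ?inE.
- exact: Aint_irr.
- by move: xi; rewrite (cfkerEirr i) inE (lin_char1 (linG i)).
Qed.

(** * The trace to the subfield of order h, and a nontrivial character invariant under x -> x^h *)

Section FrobeniusTrace.
Variables (F : finFieldType) (h n : nat).
Hypotheses (pchar_h : [pchar F].-nat h) (cardF : #|F| = (h ^ n)%N).

Definition frob_trace (x : F) := \sum_(i < n) x ^+ (h ^ i).

Lemma frob_traceD x y : frob_trace (x + y) = frob_trace x + frob_trace y.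
Proof.
rewrite -big_split; apply: eq_bigr => i _.
by rewrite exprDn_pchar // pnatX pchar_h.
Qed.

(** The h-th power permutes the terms cyclically, because x^(h^n) = x. *)
Lemma frob_trace_frob x : frob_trace (x ^+ h) = frob_trace x.
Proof.
rewrite /frob_trace.
have [m en] : exists m, n = m.+1.
  by case: n cardF (finNzRing_gt1 F) => [->|m] //; exists m.
move: cardF; rewrite en => cF; under eq_bigr do rewrite -exprM -expnS.
rewrite big_ord_recr big_ord_recl /= -cF expf_card addrC.
by congr (_ + _).
Qed.

(** The trace is a nonzero polynomial of degree at most h^(n-1), too small to vanish at all h^n
    elements. *)
Lemma frob_trace_neq0 : exists x, frob_trace x != 0.
Proof.
have F1 := finNzRing_gt1 F.
have h1 : (1 < h)%N.
  by case: h pchar_h cardF F1 => [|[|//]] // _ ->; rewrite exp1n.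
have n0 : (0 < n)%N by case: n cardF F1 => // ->.
pose T : {poly F} := \sum_(i < n) 'X^(h ^ i).
(* The coefficient of X is 1: as h > 1, only the term i = 0 contributes to it. *)
have T0 : T != 0.
  apply: contraTneq isT => /(congr1 (fun q : {poly F} => q`_1)).
  rewrite coef0 coef_sum -(big_mkord xpredT (fun i => 'X^(h ^ i)`_1)).
  rewrite big_ltn // big1_seq => [|i /andP[_]].
    by rewrite expn0 coefXn addr0 => /eqP; rewrite oner_eq0.
  rewrite mem_index_iota coefXn => /andP[i0 _].
  by rewrite ltn_eqF // -[1%N](expn0 h) ltn_exp2l.
have [/existsP[x xT]|] := boolP [exists x, ~~ root T x].
  exists x; apply: contra xT => /eqP e; rewrite /root horner_sum; apply/eqP.
  by rewrite -[RHS]e; apply: eq_bigr => i _; rewrite hornerXn.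
rewrite negb_exists => /forallP rT.
have := max_poly_roots T0 (_ : all (root T) (enum F)) (enum_uniq _).
rewrite -cardE cardF => /(_ _) sz.
have {}sz : (h ^ n < size T)%N.
  by apply: sz; apply/allP=> x _; have := rT x; rewrite negbK.
suff : (size T <= (h ^ n.-1).+1)%N.
  by move/(leq_trans sz); rewrite ltnS leq_exp2l // -{1}(prednK n0) ltnn.
apply: (leq_trans (size_sum _ _ _)); apply/bigmax_leqP=> i _.
by rewrite size_polyXn ltnS leq_exp2l // -ltnS prednK.
Qed.

End FrobeniusTrace.

(** A character of F nontrivial at some trace value is composed with the trace, so no character of
    the subfield has to be built. *)
Lemma frobenius_invariant_char (F : finFieldType) (h n : nat) :
  [pchar F].-nat h -> #|F| = (h ^ n)%N ->
  exists psi : F -> algC,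
    [/\ additive_char psi, forall x, psi (x ^+ h) = psi x
      & exists x, psi x != 1].
Proof.
move=> ph cardF; have [x0 tx0] := frob_trace_neq0 ph cardF.
have [psi [[psi0 psiD psiN psiA] psi1]] := separating_linear_char tx0.
have tD := frob_traceD n ph.
have t0 : frob_trace h n (0 : F) = 0.
  by apply: (addrI (frob_trace h n (0 : F))); rewrite -tD !addr0.
exists (psi \o frob_trace h n); split=> [|x|] /=; first split=> [|x y|x|x] /=.
- by rewrite t0.
- by rewrite tD psiD.
- rewrite -psiN; congr psi; apply: (addrI (frob_trace h n x)).
  by rewrite -tD !subrr.
- exact: psiA.
- by rewrite frob_trace_frob.
- by exists x0.
Qed.

(** * Power sums of a nontrivial additive character *)

Section PowerSums.
Variables (F : finFieldType) (psi : F -> algC).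
Hypotheses (psi_char : additive_char psi) (psi_neq1 : exists x, psi x != 1).

(** Translation by [z] preserves the sum and also multiplies it by [phi z]. A subset [A] is allowed
    because the radical of a form is summed over later. *)
Lemma sum_char_eq0 (A : {set F}) (phi : F -> algC) z :
    (forall x, (z + x \in A) = (x \in A)) ->
    {in A, forall x, phi (z + x) = phi z * phi x} -> phi z != 1 ->
  \sum_(x in A) phi x = 0.
Proof.
move=> Az phiD phi1; apply: contraNeq phi1 => S0; apply/eqP.
apply: (mulIf S0); rewrite mul1r [in RHS](reindex_inj (addrI z)) /=.
by rewrite mulr_sumr; apply: eq_big => x; rewrite ?Az // => /phiD.
Qed.

Lemma sum_psi c : \sum_x psi (c * x) = if c == 0 then #|F|%:R else 0.
Proof.
have [psi0 psiD _ _] := psi_char.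
have [->|c0] := eqVneq c 0.
  under eq_bigr do rewrite mul0r psi0.
  by rewrite sumr_const.
have [x psix] := psi_neq1.
rewrite (eq_bigl (mem [set: F])) => [|y]; last by rewrite !inE.
apply: (@sum_char_eq0 _ _ (x / c)) => [y|y _|]; rewrite ?inE //.
  by rewrite mulrDr psiD.
by rewrite mulrC divfK.
Qed.

Definition power_sum m a := \sum_x psi (a * x ^+ m).

Lemma power_sum0 m : power_sum m 0 = #|F|%:R.
Proof.
have [psi0 _ _ _] := psi_char.
by rewrite /power_sum; under eq_bigr do rewrite mul0r psi0; rewrite sumr_const.
Qed.

(** Each nonzero m-th power has exactly m preimages. *)
Lemma sum_units_pow m (f : F -> algC) : (m %| #|F|.-1)%N ->
  \sum_(x | x != 0) f (x ^+ m) =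
  m%:R * \sum_(u in [set x ^+ m | x in [set~ 0]]) f u.
Proof.
move=> dm; transitivity (\sum_(x in [set~ 0]) f (x ^+ m)).
  by apply: eq_bigl => x; rewrite !inE.
rewrite (partition_big_imset (fun x => x ^+ m)) mulr_sumr.
apply: eq_bigr => u /imsetP[y]; rewrite !inE => y0 ->.
have m0 := dvdn_gt0 (card_units_gt0 F) dm.
under eq_bigr => x /andP[_ /eqP ->] do [].
rewrite sumr_const -[LHS]mulr_natl; congr (_%:R * _).
rewrite -[RHS](card_pow_fibre dm y0); apply: eq_card => x; rewrite !inE.
rewrite unfold_in /= !inE.
have [->|x0] := eqVneq x 0; rewrite ?eqxx //=.
by rewrite expr0n eqn0Ngt m0 /= eq_sym expf_eq0 (negPf y0) andbF.
Qed.

Lemma card_units_pow m : (m %| #|F|.-1)%N ->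
  (m * #|[set (x : F) ^+ m | x in [set~ 0%R]]|)%N = #|F|.-1.
Proof.
move=> dm; have := sum_units_pow (fun=> 1) dm.
rewrite !sumr_const -natrM => /eqP; rewrite eqr_nat => /eqP <-.
by rewrite -(cardsC1 (0 : F)); apply: eq_card => x; rewrite !inE.
Qed.

Lemma power_sumE m a : (0 < m)%N ->
  power_sum m a = 1 + \sum_(x | x != 0) psi (a * x ^+ m).
Proof.
have [psi0 _ _ _] := psi_char.
by move=> m0; rewrite /power_sum (bigD1 0) //= expr0n eqn0Ngt m0 mulr0 psi0.
Qed.

(** The term x = 0 gives 1, and every other value occurs m times. *)
Lemma power_sum_mod m a : (m %| #|F|.-1)%N ->
  exists2 g : algC, g \in Aint & power_sum m a = 1 + m%:R * g.
Proof.
have [_ _ _ psiA] := psi_char => dm.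
have m0 := dvdn_gt0 (card_units_gt0 F) dm.
rewrite power_sumE // (sum_units_pow (fun x => psi (a * x)) dm).
by eexists; last reflexivity; apply: rpred_sum.
Qed.

(** The cofactor g = (M - 1)/m is a rational algebraic integer, hence an integer. *)
Lemma power_sum_int_mod m a (M : int) : (m %| #|F|.-1)%N ->
  power_sum m a = M%:~R -> (m%:Z %| M - 1)%Z.
Proof.
move=> dm eM; have [g gA] := power_sum_mod a dm; rewrite eM => eg.
have m0 := dvdn_gt0 (card_units_gt0 F) dm.
have mC : m%:R != 0 :> algC by rewrite pnatr_eq0 -lt0n.
have gE : g = (M - 1)%:~R / m%:R.
  by rewrite rmorphB /= eg addrC addKr mulrC mulKf.
have /intrP[j gj] : g \is a Num.int.
  apply: Cint_rat_Aint gA; rewrite gE rpred_div ?rpred_nat //.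
  by rewrite rpred_int.
apply/dvdzP; exists j; apply/eqP; rewrite -(eqr_int algC).
by rewrite rmorphM /= -gj gE divfK.
Qed.

(** Substituting zx for x negates the argument of [psi], which conjugates each term. *)
Lemma power_sum_conj m a : (0 < m)%N -> (exists z : F, z ^+ m = -1) ->
  (power_sum m a)^* = power_sum m a.
Proof.
have [_ _ psiN _] := psi_char => m0 -[z zm].
have z0 : z != 0.
  apply: contra_eq_neq zm => ->.
  by rewrite expr0n eqn0Ngt m0 eq_sym oppr_eq0 oner_eq0.
rewrite /power_sum rmorph_sum [RHS](reindex_inj (mulfI z0)) /=.
by apply: eq_bigr => x _; rewrite exprMn zm mulN1r mulrN psiN.
Qed.

Lemma sum_power_sum m : (0 < m)%N -> \sum_a power_sum m a = #|F|%:R.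
Proof.
move=> m0; rewrite exchange_big /= (bigD1 0) //= [X in _ + X]big1 => [|x x0].
  rewrite addr0 -[RHS](power_sum0 m) /power_sum.
  by apply: eq_bigr => a _; rewrite expr0n eqn0Ngt m0 mulr0 mul0r.
under eq_bigr do rewrite mulrC.
by rewrite sum_psi expf_eq0 (negPf x0) andbF.
Qed.

Lemma sum_power_sum_neq0 m : (0 < m)%N ->
  \sum_(a | a != 0) power_sum m a = 0.
Proof.
move=> m0; apply: (addrI (power_sum m 0)).
by rewrite addr0 [RHS]power_sum0 -[RHS](sum_power_sum m0) [RHS](bigD1 0).
Qed.

(** The sums over a != 0 add up to 0. If b of them take the second value, this reads E (|F| - 1 - m
    b) = 0. *)
Lemma card_large_power_sum m (E : algC) : (0 < m)%N -> E != 0 ->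
    (forall a, a != 0 -> power_sum m a = E \/ power_sum m a = E * (1 - m%:R)) ->
  (m * #|[set a : F | a != 0 & power_sum m a == E * (1 - m%:R)]%R|)%N = #|F|.-1.
Proof.
move=> m0 E0 two; set B := [set a | _].
have mC : m%:R != 0 :> algC by rewrite pnatr_eq0 -lt0n.
have val a : a != 0 -> power_sum m a = E * (1 - m%:R * (a \in B)%:R).
  move=> a0; rewrite inE a0 /=; case: eqP => [->|]; first by rewrite mulr1.
  by case: (two a a0) => -> // _; rewrite mulr0 subr0 mulr1.
have := sum_power_sum_neq0 m0; under eq_bigr => a a0 do rewrite val //.
rewrite -mulr_sumr sumrB -mulr_sumr => /eqP; rewrite mulf_eq0 (negPf E0) /=.
rewrite subr_eq0 -natr_sum -natrM sumr_const eqr_nat => /eqP.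
rewrite card_neq0.
move=> ->; congr (_ * _)%N; rewrite -sum1_card [RHS]big_mkcond [LHS]big_mkcond.
by rewrite /=; apply: eq_bigr => a _; rewrite !inE; case: eqP; case: eqP.
Qed.

Lemma power_sum_mull m c x : x != 0 -> power_sum m (c * x ^+ m) = power_sum m c.
Proof.
move=> x0; rewrite /power_sum [RHS](reindex_inj (mulfI x0)) /=.
by apply: eq_bigr => y _; rewrite exprMn mulrA.
Qed.

(** Write D = e d. For fixed x != 0, a y^d x^D = a (x^e y)^d, and y -> x^e y permutes the units. *)
Lemma power_sum_dvd d D a : (0 < D)%N -> (d %| D)%N ->
  (#|F|.-1)%:R * power_sum d a = \sum_(y | y != 0) power_sum D (a * y ^+ d).
Proof.
have [psi0 _ _ _] := psi_char => D0 /dvdnP[e eD].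
have d0 : (0 < d)%N by move: D0; rewrite eD muln_gt0 => /andP[].
have cF := card_neq0 F.
rewrite exchange_big /= (bigD1 0) //= expr0n eqn0Ngt D0.
under eq_bigr do rewrite mulr0 psi0.
rewrite sumr_const cF power_sumE // mulrDr mulr1; congr (_ + _).
rewrite -cF mulr_natl -sumr_const; apply: eq_bigr => x x0.
rewrite (reindex_inj (mulfI (expf_neq0 e (x0 : x != 0)))) /=.
rewrite [LHS]big_mkcond [RHS]big_mkcond; apply: eq_bigr => y _.
rewrite mulf_eq0 expf_eq0 (negPf (x0 : x != 0)) andbF /=.
by case: ifP => // _; rewrite exprMn -exprM -eD -mulrA [x ^+ D * _]mulrC.
Qed.

Lemma power_sum_dvd_two_values d D a (E : algC) :
    (0 < D)%N -> (D %| #|F|.-1)%N -> (d %| D)%N -> E != 0 -> a != 0 ->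
    (forall c, c != 0 -> power_sum D c = E \/ power_sum D c = E * (1 - D%:R)) ->
  power_sum d a = E \/ power_sum d a = E * (1 - d%:R).
Proof.
move=> D0 dD dd E0 a0 two; set n := #|F|.-1.
have nC : n%:R != 0 :> algC by rewrite pnatr_eq0 -lt0n card_units_gt0.
have cF : #|[pred a : F | a != 0]| = n := card_neq0 F.
have := card_large_power_sum D0 E0 two; set B := [set a | _] => cB.
have val c : c != 0 -> power_sum D c = E * (1 - D%:R * (c \in B)%:R).
  move=> c0; rewrite inE c0 /=; case: eqP => [->|]; first by rewrite mulr1.
  by case: (two c c0) => -> // _; rewrite mulr0 subr0 mulr1.
have eS : n%:R * power_sum d a =
    E * (n%:R - D%:R * (\sum_(y : F | y != 0%R) (a * y ^+ d \in B)%R)%N%:R).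
  rewrite (power_sum_dvd a D0 dd).
  under eq_bigr => y y0 do rewrite val ?mulf_neq0 ?expf_neq0 //.
  by rewrite -mulr_sumr sumrB -mulr_sumr sumr_const cF -natr_sum.
have [/existsP[y0 /andP[y00 By0]]|noB] :=
  boolP [exists y : F, (y != 0) && (a * y ^+ d \in B)]; last first.
  left; apply: (mulfI nC); rewrite eS big1 => [|y y0].
    by rewrite mulr0 subr0 mulrC.
  apply/eqP; rewrite eqb0; apply: contra noB => By.
  by apply/existsP; exists y; rewrite y0.
right; apply: (mulfI nC); rewrite eS.
set c := a * y0 ^+ d in By0; have c0 : c != 0 by rewrite mulf_neq0 ?expf_neq0.
(* The coset of [c] lies in [B] and has the same cardinality. *)
have eB : B = [set c * u | u in [set x ^+ D | x in [set~ 0]]].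
  apply/esym/eqP; rewrite eqEcard; apply/andP; split.
    apply/subsetP=> _ /imsetP[_ /imsetP[x + ->] ->]; rewrite !inE => x0.
    rewrite mulf_neq0 ?expf_neq0 //= power_sum_mull //.
    by move: By0; rewrite inE => /andP[].
  rewrite card_imset ?(leq_pmul2l D0) //; last exact: mulfI.
  by rewrite -(leq_pmul2l D0) cB (card_units_pow dD).
(* Each u = c x^D in [B] equals a (y0 x^e)^d, hence is hit by exactly d values of y. *)
have -> : (\sum_(y : F | y != 0%R) (a * y ^+ d \in B)%R = #|B| * d)%N.
  transitivity (\sum_(u in B) \sum_(y : F | ((y != 0) && (a * y ^+ d == u))%R) 1)%N.
    rewrite (exchange_big_dep (fun y : F => y != 0)) /= => [|u y _ /andP[]//].
    apply: eq_bigr => y yN0; rewrite yN0 /=.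
    have [By|/negPf nBy] := boolP (a * y ^+ d \in B).
      by rewrite (big_pred1 (a * y ^+ d)) // => u /=; rewrite eq_sym andbC;
         case: eqP => // ->.
    by rewrite big1 // => u /andP[Bu /eqP eu]; rewrite eu Bu in nBy.
  rewrite -sum_nat_const; apply: eq_bigr => u.
  rewrite {1}eB => /imsetP[_ /imsetP[x + ->] ->]; rewrite !inE => x0.
  case/dvdnP: dd => e eD.
  have dF : (d %| n)%N by apply: dvdn_trans dD; rewrite eD dvdn_mull.
  have d0 : (0 < d)%N by move: D0; rewrite eD muln_gt0 => /andP[].
  have z0 : y0 * x ^+ e != 0 by rewrite mulf_neq0 ?expf_neq0.
  rewrite -[RHS](card_pow_fibre dF z0) sum1dep_card; apply: eq_card => y.
  rewrite !inE /c eD exprM -mulrA -exprMn (inj_eq (mulfI a0)).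
  have [->|//] := eqVneq y 0.
  by rewrite expr0n eqn0Ngt d0 eq_sym (negPf (expf_neq0 _ z0)).
rewrite natrM mulrA -natrM cB -/n; ring.
Qed.

End PowerSums.

(** * Evaluation of the sums with exponent h + 1 *)

Section HermitianSum.
Variables (F : finFieldType) (psi : F -> algC) (h k : nat).
Hypotheses (psi_char : additive_char psi) (psi_neq1 : exists x, psi x != 1).
Hypotheses (pchar_h : [pchar F].-nat h) (psi_frob : forall x, psi (x ^+ h) = psi x).
Hypotheses (h_gt1 : (1 < h)%N) (cardF : #|F| = (h ^ (2 * k))%N).

Let frobD (x y : F) : (x + y) ^+ h = x ^+ h + y ^+ h.
Proof. exact: exprDn_pchar. Qed.

Let frob_inj : injective (fun x : F => x ^+ h).
Proof.
move=> x y /= e; apply/eqP; rewrite -subr_eq0.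
have : (x - y) ^+ h == 0.
  by apply/eqP/(addIr (y ^+ h)); rewrite -frobD subrK add0r.
by rewrite expf_eq0 => /andP[].
Qed.

(* The cross terms a y^h z + a z^h y of a (y + z)^(h+1) have the same image
   under psi as polar a z * y^h, because psi is invariant under x |-> x^h. *)
Definition polar a z : F := a * z + a ^+ h * z ^+ (h * h).

Lemma polarD a z x : polar a (z + x) = polar a z + polar a x.
Proof. rewrite /polar exprM !frobD -!exprM; ring. Qed.

Lemma psi_polar a y z :
  psi (a * (y + z) ^+ h.+1) =
  psi (a * y ^+ h.+1) * psi (a * z ^+ h.+1) * psi (polar a z * y ^+ h).
Proof.
have [_ psiD _ _] := psi_char.
have -> : a * (y + z) ^+ h.+1 =
    a * y ^+ h.+1 + a * z ^+ h.+1 + (a * z * y ^+ h + a * z ^+ h * y).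
  by rewrite !exprS frobD; ring.
rewrite !psiD; congr (_ * _).
rewrite -(psi_frob (a * z ^+ h * y)) -psiD; congr psi.
by rewrite !exprMn -exprM /polar; ring.
Qed.

(** In the double sum, one variable is shifted by the other. Summing over y, where y -> y^h is a
    bijection, leaves only the z with [polar a z] zero. *)
Lemma hermitian_sum_norm a :
  power_sum psi h.+1 a * (power_sum psi h.+1 a)^* =
  #|F|%:R * \sum_(z in [set z | polar a z == 0]) psi (a * z ^+ h.+1).
Proof.
have [psi0 psiD psiN _] := psi_char.
rewrite /power_sum rmorph_sum mulr_sumr.
transitivity (\sum_y \sum_z psi (a * z ^+ h.+1) * psi (polar a z * y ^+ h)).
  apply: eq_bigr => y _; rewrite mulr_suml (reindex_inj (addrI y)) /=.
  apply: eq_bigr => z _; rewrite psi_polar -psiN.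
  rewrite -mulrA mulrC -[RHS]mulr1 -psi0 -(addrN (a * y ^+ h.+1)) psiD.
  by ring.
rewrite exchange_big mulr_sumr [RHS]big_mkcond /=; apply: eq_bigr => z _.
rewrite inE -mulr_sumr.
have <- : \sum_y psi (polar a z * y) = \sum_y psi (polar a z * y ^+ h).
  by rewrite [LHS](reindex_inj frob_inj).
by rewrite sum_psi //; case: eqP; rewrite ?mulr0 // mulrC.
Qed.

(** On the radical, z -> psi(a z^(h+1)) is itself an additive character, trivial or not. *)
Lemma hermitian_radical_sum a :
  \sum_(z in [set z | polar a z == 0]) psi (a * z ^+ h.+1) \in
    [:: 0; #|[set z | polar a z == 0]|%:R].
Proof.
have [psi0 _ _ _] := psi_char; set Z := [set z | _].
have psiZD z x : x \in Z ->
    psi (a * (z + x) ^+ h.+1) = psi (a * z ^+ h.+1) * psi (a * x ^+ h.+1).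
  by rewrite inE psi_polar => /eqP ->; rewrite mul0r psi0 mulr1.
have [/existsP[z /andP[Zz z1]]|] :=
  boolP [exists z, (z \in Z) && (psi (a * z ^+ h.+1) != 1)].
  rewrite (sum_char_eq0 (phi := fun z => psi (a * z ^+ h.+1)) _ _ z1) ?mem_head //.
    by move=> x; move: Zz; rewrite !inE polarD => /eqP ->; rewrite add0r.
  by move=> x Zx; apply: psiZD.
rewrite negb_exists => /forallP tr; rewrite (eq_bigr (fun=> 1)) => [|z Zz].
  by rewrite sumr_const !inE eqxx orbT.
by have := tr z; rewrite Zz negbK => /eqP.
Qed.

(** Nonzero radical elements are the solutions of z^(h^2-1) = -a/a^h. As h^2 - 1 divides |F| - 1,
    there are none or h^2 - 1 of them. *)
Lemma card_hermitian_radical a : a != 0 ->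
  #|[set z | polar a z == 0]| \in [:: 1; h ^ 2]%N.
Proof.
move=> a0; set Z := [set z | _].
have Z0 : 0 \in Z.
  by rewrite inE /polar expr0n muln_eq0 orbb eqn0Ngt ltnW //= !mulr0 addr0.
have [/existsP[z /andP[Zz z0]]|noZ] := boolP [exists z, (z \in Z) && (z != 0)];
    last first.
  rewrite inE; apply/orP; left; apply/eqP; rewrite -[RHS](cards1 (0 : F)).
  apply: eq_card => z; rewrite inE; have [->|z0] := eqVneq z 0; first by rewrite Z0.
  by apply: contraNF noZ => Zz; apply/existsP; exists z; rewrite Zz.
rewrite !inE; apply/orP; right; apply/eqP.
have h2 : (0 < h ^ 2)%N by rewrite expn_gt0 ltnW.
have dn : ((h ^ 2).-1 %| #|F|.-1)%N.
  by rewrite cardF expnM [X in (_ %| X)%N]predn_exp dvdn_mulr.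
rewrite (cardsD1 0) Z0 add1n -[RHS](prednK h2); congr _.+1.
rewrite -[RHS](card_pow_fibre dn z0); apply: eq_card => x; rewrite !inE.
have [->|x0] := eqVneq x 0.
  have h21 : (0 < (h ^ 2).-1)%N by rewrite -ltnS prednK // (ltn_exp2l 0).
  by rewrite expr0n eqn0Ngt h21 /= eq_sym expf_eq0 (negPf z0) andbF.
have polarE y : y != 0 ->
    (polar a y == 0) = (y ^+ (h ^ 2).-1 == - (a / a ^+ h)).
  move=> y0; rewrite /polar mulnn -(prednK h2) exprS /=.
  rewrite [a ^+ h * _]mulrCA [a * y]mulrC -mulrDr mulf_eq0 (negPf y0) /=.
  rewrite addrC addr_eq0 -[RHS](inj_eq (mulfI (expf_neq0 h a0))).
  by rewrite mulrN [a ^+ h * (_ / _)]mulrC divfK ?expf_neq0.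
by move: Zz; rewrite inE !polarE // => /eqP <-.
Qed.

(** Here S is real with S^2 equal to 0, h^(2k) or h^(2k+2). The congruence S = 1 modulo h + 1
    excludes 0 and fixes the sign of S. *)
Lemma hermitian_sum_value a : a != 0 ->
  power_sum psi h.+1 a = (- h%:R) ^+ k \/
  power_sum psi h.+1 a = (- h%:R) ^+ k * (1 - h.+1%:R).
Proof.
move=> a0; set S := power_sum _ _ _.
have [e en] : exists e, #|F|.-1 = (e * h.-1 * h.+1)%N.
  rewrite cardF expnM predn_exp; eexists.
  by rewrite mulnC -mulnA -[(h ^ 2).-1]subn1 -(exp1n 2) subn_sqr addn1 subn1.
have dn : (h.+1 %| #|F|.-1)%N by rewrite en dvdn_mull.
(* For odd h the exponent (|F| - 1)/(h + 1) is even, being a multiple of h - 1; for even h, -1 = 1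
   in F. *)
have root_neg1 : exists z : F, z ^+ h.+1 = -1.
  apply: expf_root dn _; rewrite en mulnK // -signr_odd oddM.
  have [oh|/negbNE oh] := boolP (~~ odd h); last first.
    by rewrite -subn1 oddB ?(ltnW h_gt1) // oh andbF.
  have : 2%N \in [pchar F] by apply: (pnatP _ _ pchar_h); rewrite ?dvdn2 // ltnW.
  by move/oppr_pchar2 ->; rewrite expr1n.
have Sconj : S^* = S by apply: power_sum_conj.
have int_values j : S ^+ 2 = (h%:R ^+ j) ^+ 2 -> S = (- h%:R) ^+ j.
  move=> S2.
  (* Since -h = 1 modulo h + 1, the root (-h)^j has the right residue. The opposite root would force
     h + 1 to divide 2. *)
  have hj : (h.+1%:Z %| (- h%:Z) ^+ j - 1)%Z.
    rewrite subrX1 dvdz_mulr //; apply/dvdzP; exists (-1).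
    by lia.
  have : S == (- h%:R) ^+ j \/ S == - (- h%:R) ^+ j.
    apply/orP; rewrite -eqf_sqr S2 -!exprM mulnC !exprM sqrrN eqxx //.
  case=> /eqP // SE.
  have := power_sum_int_mod psi_char (a := a) (M := - (- h%:Z) ^+ j) dn.
  rewrite -/S SE rmorphN rmorphXn rmorphN /= => /(_ erefl).
  move: hj => /dvdzP[u eu] /dvdzP[v ev].
  have {}eu : (-1 - v * h.+1%:Z) - 1 = u * h.+1%:Z.
    by rewrite -eu; congr (_ - _); rewrite -ev; ring.
  have : (h.+1%:Z %| 2)%Z.
    by apply/dvdzP; exists (- (u + v)); rewrite mulNr mulrDl -eu; ring.
  by move/(@dvdn_leq h.+1 2 isT); rewrite ltnS leqNgt h_gt1.
have : S ^+ 2 \in [:: 0; #|F|%:R * 1; #|F|%:R * (h ^ 2)%:R].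
  rewrite expr2 -{2}Sconj hermitian_sum_norm.
  have := hermitian_radical_sum a; rewrite !inE => /orP[/eqP->|/eqP->].
    by rewrite mulr0 eqxx.
  have := card_hermitian_radical a0; rewrite !inE => /orP[/eqP->|/eqP->].
    by rewrite eqxx orbT.
  by rewrite eqxx !orbT.
have Q2 : #|F|%:R = (h%:R ^+ k) ^+ 2 :> algC.
  by rewrite cardF natrX mulnC exprM.
rewrite !inE Q2 mulr1 natrX -exprMn -exprSr => /or3P[/eqP S2|/eqP/int_values|].
- have S0 : S = 0 by apply/eqP; rewrite -sqrf_eq0 S2.
  have : (h.+1%:Z %| 0 - 1)%Z by apply: (power_sum_int_mod (M := 0) psi_char dn S0).
  by move/(@dvdn_leq h.+1 1 isT); rewrite ltnS leqNgt ltnW.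
- by left.
(* The factor 1 - (h + 1) is -h, so this value is (-h)^(k+1). *)
move=> /eqP/int_values ->; right.
by rewrite exprSr -natr1; ring.
Qed.

End HermitianSum.

(** * From character sums to affine and projective point counts *)

(** Orthogonality over a detects the equation, and the sum over tuples factors coordinate by
    coordinate. *)
Lemma affine_fermat_count (F : finFieldType) (psi : F -> algC) (s d : nat) :
    additive_char psi -> (exists x, psi x != 1) ->
  (#|F| * #|[set x : tup F s | fermat_eq d x]|)%:R =
  \sum_a power_sum psi d a ^+ s.+1.
Proof.
move=> psiC psi1; have [psi0 psiD _ _] := psiC.
have psi_sum (I : finType) (f : I -> F) : psi (\sum_i f i) = \prod_i psi (f i).
  exact: (big_morph psi psiD psi0).
transitivity (\sum_a \sum_(x : tup F s) psi (a * \sum_i x i ^+ d)); last first.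
  apply: eq_bigr => a _.
  have -> : power_sum psi d a ^+ s.+1 = \prod_(i < s.+1) power_sum psi d a.
    by rewrite prodr_const card_ord.
  rewrite bigA_distr_bigA /=; apply: eq_bigr => x _.
  by rewrite mulr_sumr psi_sum.
rewrite exchange_big /= natrM mulr_natr -sumr_const big_mkcond /=.
apply: eq_bigr => x _; rewrite inE -(sum_psi psiC psi1).
by apply: eq_bigr => a _; rewrite mulrC.
Qed.

(** The zero tuple is one solution; the others split into scalar classes of |F| - 1 elements
    each. *)
Lemma projective_fermat_count (F : finFieldType) (s d : nat) : (0 < d)%N ->
  (#|[set x : tup F s | fermat_eq d x]| = (Npts F s d * #|F|.-1).+1)%N.
Proof.
move=> d0; set N := [set x | _].
have eq0 : fermat_eq d (0 : tup F s).
  by rewrite /fermat_eq big1 // => i _; rewrite ffunE expr0n eqn0Ngt d0.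
have scale (c : F) (x : tup F s) : c != 0 ->
    fermat_eq d [ffun i => c * x i] = fermat_eq d x.
  move=> c0; rewrite /fermat_eq; under eq_bigr do rewrite ffunE exprMn.
  by rewrite -mulr_sumr mulf_eq0 expf_eq0 (negPf c0) andbF.
have scale_neq0 (c : F) (x : tup F s) : c != 0 ->
    ([ffun i => c * x i] == 0 :> tup F s) = (x == 0).
  move=> c0; apply/eqP/eqP => [/ffunP e|->]; apply/ffunP=> i.
    by have := e i; rewrite !ffunE => /eqP; rewrite mulf_eq0 (negPf c0) => /eqP.
  by rewrite !ffunE mulr0.
have mem_class (x y : tup F s) : proj_class x = proj_class y <-> x \in proj_class y.
  split=> [<-|/imsetP[c]].
    by apply/imsetP; exists 1; rewrite ?inE ?oner_eq0 //; apply/ffunP=> i;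
       rewrite ffunE mul1r.
  rewrite inE => c0 ->; apply/setP=> z; apply/imsetP/imsetP => -[e]; rewrite inE => e0 ->.
    by exists (e * c); rewrite ?inE ?mulf_neq0 //; apply/ffunP=> i; rewrite !ffunE mulrA.
  exists (e / c); rewrite ?inE ?mulf_neq0 ?invr_eq0 //; apply/ffunP=> i.
  by rewrite !ffunE mulrA divfK.
rewrite (cardsD1 (0 : tup F s)) inE eq0 add1n; congr _.+1.
have -> : N :\ (0 : tup F s) = [set x : tup F s | (x != 0) && fermat_eq d x].
  by apply/setP=> x; rewrite !inE.
set M := [set x | _]; rewrite -sum1_card (partition_big_imset (@proj_class F s)) /=.
rewrite -sum_nat_const; apply: eq_bigr => _ /imsetP[x + ->].
rewrite inE => /andP[x0 fx].
have -> : #|F|.-1 = #|proj_class x|.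
  rewrite card_in_imset => [|c e _ _ /ffunP eqce].
    by rewrite -(cardsC1 (0 : F)); apply: eq_card => c; rewrite !inE.
  (* A nonzero coordinate makes c -> c x injective. *)
  have [i xi] : exists i, x i != 0.
    apply/existsP; rewrite -negb_forall; apply: contra x0 => /forallP z.
    by apply/eqP/ffunP=> i; rewrite ffunE; apply/eqP.
  by have := eqce i; rewrite !ffunE => /(mulIf xi).
rewrite sum1dep_card; apply: eq_card => y; rewrite !inE.
apply/andP/idP => [[_ /eqP/mem_class //]|yx].
split; last by apply/eqP/mem_class.
by case/imsetP: yx => c; rewrite inE => c0 ->; rewrite scale ?scale_neq0 ?x0.
Qed.

(** * The constant B(d, m) and the final formula *)

(** The division defining [Bdm] is exact: d = (d - 1) - (-1) divides (d - 1)^m - (-1)^m. *)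
Lemma BdmM (d m : nat) :
  Bdm d m * d%:Z = (d%:Z - 1) ^+ m + (-1) ^+ m * (d%:Z - 1).
Proof.
rewrite /Bdm divzK //.
have -> : (d%:Z - 1) ^+ m + (-1) ^+ m * (d%:Z - 1) =
    ((d%:Z - 1) ^+ m - (-1) ^+ m) + (-1) ^+ m * d%:Z by ring.
rewrite rpredD ?dvdz_mull // subrXX opprK subrK.
exact: dvdz_mulr.
Qed.

Unset Implicit Arguments.

(** This is the point-count form, with F in the role of the field of q^k elements. The power
    q^(k(s-1)/2) is the integer p^(rk(s-1)), and the quotient is exact, being a geometric sum. *)
Theorem theorem3p2 (p r s d : nat) (F : finFieldType) (k : nat) :
  prime p -> (0 < r)%N -> (0 < s)%N -> (0 < d)%N -> (d %| p ^ r + 1)%N ->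
  (0 < k)%N -> #|F| = ((p ^ (2 * r)) ^ k)%N ->
  (Npts F s d)%:Z =
    (((p ^ (2 * r)) ^ (k * s) - 1) %/ ((p ^ (2 * r)) ^ k - 1))%N%:Z
    + (-1) ^+ ((k + 1) * (s + 1)) * (p ^ (r * k * (s - 1)))%N%:Z * Bdm d s.+1.
Proof.
move=> p_pr r0 s0 d0; rewrite addn1 => dD k0 cardF.
(* From here on [q] is the order of F, that is, the k-th power of p^(2r). *)
set h := (p ^ r)%N in dD; set q := #|F|.
have h1 : (1 < h)%N by rewrite /h -(exp1n r) ltn_exp2r ?prime_gt1.
have ph : [pchar F].-nat h.
  have pF : p \in [pchar F].
    by apply: (@card_finPcharP _ p (2 * r * k)); rewrite // cardF -expnM.
  by rewrite /h pnatX orbC (eq_pnat _ (pcharf_eq pF)) pnat_id ?orbT.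
have cardFh : #|F| = (h ^ (2 * k))%N.
  by rewrite cardF -!expnM; congr (_ ^ _)%N; lia.
have [psi [psiC psi_frob psi1]] := frobenius_invariant_char ph cardFh.
pose E : algC := (- h%:R) ^+ k.
have E0 : E != 0 by rewrite expf_neq0 // oppr_eq0 pnatr_eq0 -lt0n ltnW.
have q1 : (1 < q)%N := finNzRing_gt1 F.
have Dn : (h.+1 %| q.-1)%N.
  rewrite /q cardFh expnM [X in (_ %| X)%N]predn_exp dvdn_mulr //.
  by rewrite -subn1 -(exp1n 2) subn_sqr addn1 dvdn_mull.
have two a : a != 0 -> power_sum psi d a = E \/ power_sum psi d a = E * (1 - d%:R).
  move=> a0; apply: (power_sum_dvd_two_values psiC psi1 (D := h.+1)) => // c.
  exact: hermitian_sum_value.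
have := card_large_power_sum psiC psi1 d0 E0 two.
set B := [set a | _] => cB.
have sumS : \sum_a power_sum psi d a ^+ s.+1 =
    q%:R ^+ s.+1 + E ^+ s.+1 * (q.-1%:R + #|B|%:R * ((1 - d%:R) ^+ s.+1 - 1)).
  rewrite (bigD1 0) //= power_sum0 //; congr (_ + _).
  transitivity (\sum_(a : F | a != 0)
      E ^+ s.+1 * (1 + (a \in B)%:R * ((1 - d%:R) ^+ s.+1 - 1))).
    apply: eq_bigr => a a0; rewrite inE a0 /=; case: eqP => [->|].
      by rewrite exprMn mul1r addrCA subrr addr0.
    by case: (two a a0) => -> // _; rewrite mul0r addr0 mulr1.
  rewrite -mulr_sumr big_split /= -mulr_suml sumr_const -natr_sum.
  rewrite card_neq0; congr (_ * (_ + _%:R * _)); rewrite -sum1_card [RHS]big_mkcond [LHS]big_mkcond /=.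
  by apply: eq_bigr => a _; rewrite !inE; case: eqP; case: eqP.
have E2 : E ^+ 2 = q%:R.
  by rewrite -exprM mulnC exprM sqrrN /q cardFh natrX exprM.
have eqN : (q * (Npts F s d * q.-1).+1)%:R =
    q%:R ^+ s.+1 + E ^+ s.+1 * (q.-1%:R + #|B|%:R * ((1 - d%:R) ^+ s.+1 - 1)).
  by rewrite -sumS -(affine_fermat_count _ _ psiC psi1) projective_fermat_count.
have n0 : (0 < q.-1)%N := card_units_gt0 F.
have nC : q.-1%:R != 0 :> algC by rewrite pnatr_eq0 -lt0n.
have qC : q%:R != 0 :> algC by rewrite pnatr_eq0 -lt0n ltnW.
have dC : d%:R != 0 :> algC by rewrite pnatr_eq0 -lt0n.
(* With q - 1 = d |B|, the left side is |B| ((d - 1) + (1 - d)^(s+1)), in which d B(d, s+1) appears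
   up to the sign (-1)^(s+1). *)
have eqBd : q.-1%:R + #|B|%:R * ((1 - d%:R) ^+ s.+1 - 1) =
    q.-1%:R * (-1) ^+ s.+1 * (Bdm d s.+1)%:~R :> algC.
  apply: (mulIf dC).
  have := congr1 (fun z : int => z%:~R : algC) (BdmM d s.+1).
  rewrite rmorphM rmorphD rmorphM !rmorphXn rmorphB rmorphN /= => eB.
  have bd : #|B|%:R * d%:R = q.-1%:R :> algC by rewrite -natrM mulnC cB.
  have sgn2 : (-1) ^+ s.+1 * (-1) ^+ s.+1 = 1 :> algC.
    by rewrite -exprMn mulrNN mulr1 expr1n.
  rewrite -[RHS]mulrA eB -(opprB d%:R) [(- (_ - _)) ^+ _]exprNn.
  move: (_ ^+ _) (_ ^+ s.+1) sgn2 => P e ee.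
  transitivity (q.-1%:R * d%:R + #|B|%:R * d%:R * (e * P - 1)); first by ring.
  rewrite bd; transitivity (q.-1%:R * e * P + q.-1%:R * (e * e) * (d%:R - 1)).
    by rewrite ee; ring.
  by rewrite (_ : d%:~R = d%:R) //; ring.
have [t es] : exists t, s = t.+1 by exists s.-1; rewrite prednK.
rewrite {s0 sumS}es in eqN eqBd *; rewrite expnM -cardF -/q !subn1 predn_exp mulKn //.
have -> : (p ^ (r * k * t.+1.-1) = h ^ (k * t))%N by rewrite -mulnA expnM.
set G := (\sum_(i < t.+1) q ^ i)%N.
have eG : q%:R ^+ t.+1 = 1 + q.-1%:R * G%:R :> algC.
  by rewrite -natrM -predn_exp -natrX nat1r prednK // expn_gt0 ltnW.
(* Two factors E give q by [E2]; the other t = s - 1 give (-1)^(kt) h^(kt). The exponents kt + t + 2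
   and (k + 1)(t + 2) have the same parity. *)
have eE : E ^+ t.+2 * (-1) ^+ t.+2 =
    q%:R * ((-1) ^+ ((k + 1) * (t.+1 + 1)) * (h ^ (k * t))%N%:R).
  rewrite -[t.+2]addn2 [E ^+ _]exprD E2 -mulrA [LHS]mulrCA; congr (_ * _).
  rewrite /E -exprM [(- h%:R) ^+ _]exprNn natrX mulrAC -exprD; congr (_ * _).
  rewrite -[LHS]signr_odd -[RHS]signr_odd; congr (_ ^+ _); lia.
apply/eqP; rewrite -(eqr_int algC); apply/eqP.
(* Multiplying by q(q - 1) and adding q turns the projective count into q times the affine one. *)
apply: (mulIf nC); apply: (mulfI qC); apply: (addIr q%:R).
rewrite rmorphD !rmorphM rmorphXn rmorphN /=.
transitivity ((q * (Npts F t.+1 d * q.-1).+1)%:R : algC).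
  by rewrite natrM -natr1 natrM -![_%:~R]/(_%:R) mulrDr mulr1.
rewrite eqN eqBd exprS eG -[G%:~R]/(G%:R).
transitivity (q%:R * (1 + q.-1%:R * G%:R)
    + E ^+ t.+2 * (-1) ^+ t.+2 * (q.-1%:R * (Bdm d t.+2)%:~R)); first by ring.
rewrite eE -[(h ^ (k * t))%N%:~R]/((h ^ (k * t))%N%:R) -[1%:~R]/1; ring.
Qed.
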